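(* Let $n\ge2$ be an integer and $\lambda\in\mathbb R$. Then $$\begin{aligned}d_n(\lambda)={}&\frac1{n\sqrt{\left(\frac\lambda n-2\right)^2-4}}\left(-\frac{\left(\frac\lambda n-2\right)-\sqrt{\left(\frac\lambda n-2\right)^2-4}}{2}\right)^n\\&-\frac1{n\sqrt{\left(\frac\lambda n-2\right)^2-4}}\left(-\frac{\left(\frac\lambda n-2\right)+\sqrt{\left(\frac\lambda n-2\right)^2-4}}{2}\right)^n\\={}&\frac{(-1)^{n-1}}{n\cdot2^{n-1}}\sum_{k=1}^{\lceil n/2\rceil}\binom n{2k-1}\left(\frac\lambda n-2\right)^{n-(2k-1)}\left(\left(\frac\lambda n-2\right)^2-4\right)^{k-1},\end{aligned}$$ where the first expression is understood for $\lambda\notin\{0,4n\}$ (and by continuity at $\lambda\in\{0,4n\}$).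
   Context: For an integer $n\ge2$, $K_n$ is the $(n-1)\times(n-1)$ symmetric matrix with entries $K_n(j,k)=\min(j,k)/n-jk/n^2$, $1\le j,k\le n-1$, and $d_n(\lambda)=\det(I_{n-1}-\lambda K_n)$ is its ''alternative characteristic polynomial'' ($I_{n-1}$ the identity matrix). $\lceil x\rceil$ is the least integer greater than or equal to $x$. When $(\lambda/n-2)^2-4<0$ the square root is a complex square root (the first expression does not depend on which of the two roots is chosen). The convention $x^0=1$ (including $0^0=1$) is used. *)

(* Defs.v *)
From HB Require Import structures.
From mathcomp Require Import all_boot all_order all_algebra.
From mathcomp Require Import all_classical all_reals all_analysis.
From mathcomp Require Import complex.

Set Implicit Arguments.
Unset Strict Implicit.
Unset Printing Implicit Defensive.

Import Order.TTheory GRing.Theory Num.Theory.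
Import numFieldNormedType.Exports.

Local Open Scope classical_set_scope.
Local Open Scope ring_scope.
Local Open Scope complex_scope.

(* Ordinals start at 0, so the 1-based indices of the entry (j, k) are j.+1
   and k.+1. *)
Definition bridgemx (R : realType) (n : nat) : 'M[R]_(n.-1) :=
  \matrix_(j < n.-1, k < n.-1)
    ((minn j.+1 k.+1)%:R / n%:R - (j.+1)%:R * (k.+1)%:R / n%:R ^+ 2).

Definition altcharpoly (R : realType) (n : nat) (lam : R) : R :=
  \det (1%:M - lam *: bridgemx R n).

Definition shiftv (R : realType) (n : nat) (lam : R) : R := lam / n%:R - 2.

Definition discr (R : realType) (n : nat) (lam : R) : R :=
  shiftv n lam ^+ 2 - 4.

(* [w] stands for a complex square root of [discr n lam]. *)
Definition root_form (R : realType) (n : nat) (lam : R) (w : R[i]) : R[i] :=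
  let u : R[i] := (shiftv n lam)%:C in
  1 / (n%:R * w) * (- ((u - w) / 2)) ^+ n
  - 1 / (n%:R * w) * (- ((u + w) / 2)) ^+ n.

(* [uphalf n] is the ceiling of n / 2.  In the range of summation
   2k - 1 <= n, so the natural-number subtractions are not truncated. *)
Definition binomial_form (R : realType) (n : nat) (lam : R) : R :=
  (-1) ^+ (n - 1) / (n%:R * 2 ^+ (n - 1))
  * \sum_(1 <= k < (uphalf n).+1)
      ('C(n, 2 * k - 1))%:R * shiftv n lam ^+ (n - (2 * k - 1))
      * discr n lam ^+ (k - 1).

(* Main.v *)
(** With [T = tridiag(-1, 2, -1)] the discrete Dirichlet Laplacian of size
    [n - 1], [K_n] is its Green function: [T K_n = n^-1 I].  Since [det T = n],
    [n d_n(lam) = det (T (I - lam K_n)) = det (T - (lam / n) I)], a tridiagonal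
    Toeplitz determinant with diagonal [x = 2 - lam / n] satisfying
    [D_(m+2) = x D_(m+1) - D_m].  If [x = a + b] with [a b = 1], this gives
    [(a - b) D_(n-1) = a^n - b^n]; the binomial sum is the odd part in
    [w = a - b] of the expansion of [a^n], [b^n].  The factor [w] cancels
    unless [lam] is [0] or [4 n]; there [a = b] is [1] or [-1],
    [D_(n-1) = n a^(n-1)], and only the first binomial term survives. *)
Require Import Defs.
From HB Require Import structures.
From mathcomp Require Import all_boot all_order all_algebra.
From mathcomp Require Import all_classical all_reals all_analysis.
From mathcomp Require Import complex.
From mathcomp Require Import ring zify.

Set Implicit Arguments.
Unset Strict Implicit.
Unset Printing Implicit Defensive.

Import Order.TTheory GRing.Theory Num.Theory.
Import numFieldNormedType.Exports.

Local Open Scope classical_set_scope.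
Local Open Scope ring_scope.
Local Open Scope complex_scope.

(** * Determinants of tridiagonal Toeplitz matrices *)

Definition tridiag (A : comNzRingType) (x : A) (m : nat) : 'M[A]_m :=
  \matrix_(i < m, j < m)
    (x *+ (j == i :> nat) - (j == i.+1 :> nat)%:R - (j.+1 == i :> nat)%:R).

Lemma det_tridiag0 (A : comNzRingType) (x : A) : \det (tridiag x 0) = 1.
Proof. by rewrite det_mx00. Qed.

Lemma det_tridiag1 (A : comNzRingType) (x : A) : \det (tridiag x 1) = x.
Proof. by rewrite det_mx11 mxE /= !subr0. Qed.

Lemma det_tridiagSS (A : comNzRingType) (x : A) (m : nat) :
  \det (tridiag x m.+2) = x * \det (tridiag x m.+1) - \det (tridiag x m).
Proof.
rewrite (expand_det_row _ ord0) !big_ord_recl big1 ?addr0; last first.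
  by move=> i _; rewrite mxE /= !subr0 mul0r.
rewrite !mxE /= !subr0 mulr1n sub0r mulN1r.
congr (x * _ - _).
  rewrite /cofactor /= expr0 mul1r; congr (\det _).
  by apply/matrixP => i j; rewrite !mxE /= /bump /= !add1n !eqSS.
(* The second minor of the first row has [-1] as the only nonzero entry of its first column, so one
   more expansion leaves size [m]. *)
rewrite /cofactor [X in (-1) ^+ X](_ : _ = 1%N) // expr1 mulN1r.
rewrite (expand_det_col _ ord0) big_ord_recl big1 ?addr0; last first.
  by move=> i _; rewrite !mxE /= /bump /= !subr0 mul0r.
rewrite /cofactor !mxE /= /bump /= expr0 mul1r subr0 sub0r mulN1r opprK.
congr (\det _).
by apply/matrixP => i j; rewrite !mxE /= /bump /= !add1n !eqSS.
Qed.

(** Both sides obey the recurrence, whose characteristic roots are [a] and [b]; the induction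
    carries two consecutive sizes. Keeping the factor [a - b] on the left avoids any division in
    [A]. *)
Lemma det_tridiag_distinct (A : comNzRingType) (a b : A) (m : nat) :
  a * b = 1 ->
  (a - b) * \det (tridiag (a + b) m) = a ^+ m.+1 - b ^+ m.+1.
Proof.
move=> ab1; suff [] : (a - b) * \det (tridiag (a + b) m) = a ^+ m.+1 - b ^+ m.+1
  /\ (a - b) * \det (tridiag (a + b) m.+1) = a ^+ m.+2 - b ^+ m.+2 by [].
elim: m => [|m [IH0 IH1]].
  by rewrite det_tridiag0 det_tridiag1; split; ring.
split=> //; rewrite det_tridiagSS mulrBr mulrCA IH1 IH0.
(* Inserting the factor [a * b = 1] turns the goal into a polynomial identity. *)
suff -> : a ^+ m.+1 - b ^+ m.+1 = a * b * (a ^+ m.+1 - b ^+ m.+1).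
  by rewrite !exprS; ring.
by rewrite ab1 mul1r.
Qed.

(** Confluent case: when the roots coincide, the previous identity reads [0 = 0]. *)
Lemma det_tridiag_double (A : comNzRingType) (a : A) (m : nat) :
  a * a = 1 -> \det (tridiag (a + a) m) = m.+1%:R * a ^+ m.
Proof.
move=> aa1; suff [] : \det (tridiag (a + a) m) = m.+1%:R * a ^+ m
  /\ \det (tridiag (a + a) m.+1) = m.+2%:R * a ^+ m.+1 by [].
elim: m => [|m [IH0 IH1]].
  by rewrite det_tridiag0 det_tridiag1; split; ring.
split=> //; rewrite det_tridiagSS IH1 IH0.
suff -> : m.+1%:R * a ^+ m = m.+1%:R * (a * a) * a ^+ m.
  by rewrite !exprS -!natr1; ring.
by rewrite aa1 mulr1.
Qed.

Lemma rmorph_det_tridiag (A B : comNzRingType) (f : {rmorphism A -> B}) (x : A)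
    (m : nat) : f (\det (tridiag x m)) = \det (tridiag (f x) m).
Proof.
rewrite -det_map_mx; congr (\det _); apply/matrixP => i j.
by rewrite !mxE !rmorphB rmorphMn !rmorph_nat.
Qed.

(** * The Green function of the discrete Laplacian *)

Lemma sum_ord_delta (A : comNzRingType) (m a : nat) (f : nat -> A) :
  \sum_(j < m) (j == a :> nat)%:R * f j = (a < m)%N%:R * f a.
Proof.
case: ltnP => [am|ma].
  rewrite (bigD1 (Ordinal am)) //= eqxx big1 ?addr0 // => j ja.
  suff /negbTE -> : j != a :> nat by rewrite mul0r.
  by apply: contra ja => /eqP ja; apply/eqP/val_inj.
rewrite mul0r big1 // => j _.
by rewrite ltn_eqF ?mul0r // (leq_trans _ ma).
Qed.

(** In its row index, a column of [bridgemx] is piecewise linear, vanishes at both ends [0] and [n],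
    and has its only kink on the diagonal, with slope dropping by [n^-1]. *)
Lemma tridiag_mul_bridgemx (R : realType) (n : nat) : (0 < n)%N ->
  tridiag 2 n.-1 *m bridgemx R n = (n%:R^-1)%:M.
Proof.
case: n => // m _; set n := m.+1; apply/matrixP => i k; rewrite !mxE.
have n0 : n%:R != 0 :> R by rewrite pnatr_eq0.
pose f (j : nat) : R :=
  (minn j.+1 k.+1)%:R / n%:R - j.+1%:R * k.+1%:R / n%:R ^+ 2.
transitivity (2 * \sum_(j < m) (j == i :> nat)%:R * f j
    - \sum_(j < m) (j == i.+1 :> nat)%:R * f j
    - \sum_(j < m) (j.+1 == i :> nat)%:R * f j).
  rewrite mulr_sumr -!sumrB; apply: eq_bigr => j _.
  by rewrite !mxE -/(f j) -mulr_natr; ring.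
rewrite !sum_ord_delta ltn_ord.
(* In the last row the missing neighbour would have 1-based index [n], where [f] vanishes. *)
have -> : (i.+1 < m)%N%:R * f i.+1 = f i.+1.
  case: ltnP => [_|mi]; first by rewrite mul1r.
  have im : i.+1 = m by apply/eqP; rewrite eqn_leq mi ltn_ord.
  rewrite mul0r /f im (minn_idPr _); last by rewrite (leq_trans (ltn_ord k)).
  by rewrite -/n; field.
(* The left neighbour has 1-based index [i]; for [i = 0] this is the other end, again with value
   0. *)
have -> : \sum_(j < m) (j.+1 == i :> nat)%:R * f j =
    (minn i k.+1)%:R / n%:R - i%:R * k.+1%:R / n%:R ^+ 2.
  case: i => [[|i] im] /=.
    by rewrite big1 ?min0n ?mul0r ?subrr // => j _; rewrite mul0r.
  under eq_bigr do rewrite eqSS.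
  by rewrite sum_ord_delta (ltnW im) mul1r.
have -> : (i == k) = (i == k :> nat) by [].
rewrite /f mul1r; move: (nat_of_ord i) (nat_of_ord k) => p q.
(* The negated second difference of the minimum is the Kronecker delta. *)
have minE : (2 * minn p.+1 q.+1 = (p == q) + minn p.+2 q.+1 + minn p q.+1)%N.
  by lia.
have {}minE : 2 * (minn p.+1 q.+1)%:R =
    (p == q)%:R + (minn p.+2 q.+1)%:R + (minn p q.+1)%:R :> R.
  by rewrite -!natrD -natrM minE.
have -> : n%:R^-1 *+ (p == q) = (p == q)%:R / n%:R :> R by rewrite mulr_natl.
have -> : (p == q)%:R = 2 * (minn p.+1 q.+1)%:R - (minn p.+2 q.+1)%:R
    - (minn p q.+1)%:R :> R by rewrite minE; ring.
by rewrite -!natr1; field.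
Qed.

(** * Odd part of a binomial expansion *)

Lemma sum_odd (A : nmodType) (n : nat) (F : nat -> A) :
  \sum_(0 <= i < n | odd i) F i = \sum_(1 <= k < n./2.+1) F (2 * k - 1)%N.
Proof.
elim: n => [|n IH]; first by rewrite !big_geq.
rewrite big_mkcond big_nat_recr //= -big_mkcond /= IH.
rewrite uphalf_half; case: ifP => on /=; last by rewrite addr0 add0n.
rewrite add1n [RHS]big_nat_recr //=; congr (_ + F _).
by have := odd_double_half n; rewrite on; lia.
Qed.

(** Even powers of [w] cancel and odd ones double; pulling out one [w] leaves powers of [w ^+ 2]. *)
Lemma exprD_sub_exprB (A : comNzRingType) (u w : A) (n : nat) :
  (u + w) ^+ n - (u - w) ^+ n =
  2 * w * \sum_(1 <= k < (uphalf n).+1)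
      ('C(n, 2 * k - 1))%:R * u ^+ (n - (2 * k - 1)) * (w ^+ 2) ^+ (k - 1).
Proof.
rewrite exprDn exprBn -sumrB.
pose F i := 2 * w * (('C(n, i))%:R * u ^+ (n - i) * w ^+ i.-1).
transitivity (\sum_(0 <= i < n.+1 | odd i) F i).
  rewrite [RHS]big_mkcond [RHS]big_mkord; apply: eq_bigr => i _.
  rewrite /F -signr_odd.
  case: (boolP (odd i)) => [|_]; last by rewrite expr0 mul1r subrr.
  case: (nat_of_ord i) => // j _; rewrite expr1 exprS /=.
  rewrite -[X in X - _]mulr_natl -[X in _ - X]mulr_natl.
  by move: (u ^+ _) (w ^+ _) (_%:R) => c d e; ring.
rewrite sum_odd mulr_sumr; apply: eq_big_nat => k /andP[k0 _].
rewrite /F -exprM; congr (_ * (_ * _ ^+ _)); lia.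
Qed.

(** * Closed forms of the alternative characteristic polynomial *)

Lemma altcharpolyE (R : realType) (n : nat) (lam : R) : (0 < n)%N ->
  altcharpoly n lam = \det (tridiag (- shiftv n lam) n.-1) / n%:R.
Proof.
move=> n_gt0; have n0 : n%:R != 0 :> R by rewrite pnatr_eq0 -lt0n.
(* Here [2 = 1 + 1], the double root [a = 1]. *)
have detT : \det (tridiag 2 n.-1) = n%:R :> R.
  rewrite -[2]/(1 + 1) det_tridiag_double ?mulr1 //.
  by rewrite expr1n mulr1 prednK.
rewrite -detT in n0 *; apply: (mulIf n0); rewrite divfK // mulrC -det_mulmx.
congr (\det _); rewrite mulmxBr mulmx1 -scalemxAr tridiag_mul_bridgemx //.
apply/matrixP => i j; rewrite !mxE /shiftv.
have -> : (i == j) = (j == i :> nat) by rewrite eq_sym.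
by case: (j == i :> nat); rewrite ?mulr1n ?mulr0n; ring.
Qed.

Lemma discr_eq0 (R : realType) (n : nat) (lam : R) : (0 < n)%N ->
  (discr n lam == 0) = (lam \in [:: 0; 4 * n%:R]).
Proof.
move=> n_gt0; have n0 : n%:R != 0 :> R by rewrite pnatr_eq0 -lt0n.
have -> : discr n lam = lam * (lam - 4 * n%:R) / n%:R ^+ 2.
  by rewrite /discr /shiftv; field.
by rewrite !mulf_eq0 invr_eq0 expf_eq0 /= (negbTE n0) orbF subr_eq0 !inE.
Qed.

Lemma det_tridiag_complex (R : realType) (n : nat) (lam : R) (w : R[i]) :
  (0 < n)%N -> w ^+ 2 = (discr n lam)%:C ->
  let u := (shiftv n lam)%:C in
  w * (\det (tridiag (- shiftv n lam) n.-1))%:C =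
  (- ((u - w) / 2)) ^+ n - (- ((u + w) / 2)) ^+ n.
Proof.
move=> n_gt0 w2 u; rewrite (rmorph_det_tridiag (real_complex R)) rmorphN -/u.
(* The two bases in [root_form] are the roots [a] and [b]: their product is 1, their sum [- u] and
   their difference [w]. *)
have ab1 : - ((u - w) / 2) * - ((u + w) / 2) = 1.
  transitivity ((u ^+ 2 - w ^+ 2) / 4); first by field.
  by rewrite w2 /discr rmorphB rmorphXn -/u rmorph_nat; field.
have := det_tridiag_distinct n.-1 ab1; rewrite (prednK n_gt0) => <-.
have -> : - ((u - w) / 2) - - ((u + w) / 2) = w by field.
by have -> : - ((u - w) / 2) + - ((u + w) / 2) = - u by field.
Qed.

Lemma altcharpoly_root_form (R : realType) (n : nat) (lam : R) (w : R[i]) :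
  (0 < n)%N -> w ^+ 2 = (discr n lam)%:C -> lam \notin [:: 0; 4 * n%:R] ->
  (altcharpoly n lam)%:C = root_form n lam w.
Proof.
move=> n_gt0 w2 lamP; have n0 : n%:R != 0 :> R[i] by rewrite pnatr_eq0 -lt0n.
have w0 : w != 0.
  apply: contra lamP => /eqP w0; rewrite -discr_eq0 //.
  by rewrite -(inj_eq (@complexI R)) -w2 w0 expr0n.
rewrite altcharpolyE // rmorphM fmorphV rmorph_nat /root_form -mulrBr.
rewrite -(det_tridiag_complex n_gt0 w2).
by set D := (\det _)%:C; field; rewrite w0 n0.
Qed.

Lemma altcharpoly_binomial_form (R : realType) (n : nat) (lam : R) :
  (0 < n)%N -> altcharpoly n lam = binomial_form n lam.
Proof.
move=> n_gt0; have n0 : n%:R != 0 :> R by rewrite pnatr_eq0 -lt0n.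
rewrite altcharpolyE // /binomial_form; set S := bigop _ _ _.
suff -> : \det (tridiag (- shiftv n lam) n.-1) =
    (-1) ^+ (n - 1) / 2 ^+ (n - 1) * S.
  by field; rewrite n0 expf_neq0.
(* A zero discriminant forces [w = 0], which cannot be cancelled; the double-root formula takes
   over. *)
have [d0|d0] := eqVneq (discr n lam) 0.
  have -> : S = n%:R * shiftv n lam ^+ (n - 1).
    (* Only [k = 1] survives, through [0 ^+ 0 = 1]. *)
    rewrite /S big_ltn ?ltnS ?uphalf_gt0 // d0 bin1 subnn expr0 mulr1.
    rewrite big_nat big1 ?addr0 // => k /andP[k1 _].
    by rewrite expr0n subn_eq0 leqNgt k1 mulr0.
  pose a := - (shiftv n lam / 2).
  have a2 : a * a = 1.
    transitivity (discr n lam / 4 + 1); first by rewrite /a /discr; field.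
    by rewrite d0; ring.
  have -> : - shiftv n lam = a + a by rewrite /a; field.
  rewrite det_tridiag_double // prednK // subn1.
  by rewrite /a (exprNn (_ / 2)) expr_div_n; ring.
(* The discriminant may be negative, so the identity is checked in [R[i]] after multiplication by
   [w], then pulled back to [R]. *)
pose w := sqrtC ((discr n lam)%:C : R[i]).
have w2 : w ^+ 2 = (discr n lam)%:C by rewrite sqrtCK.
have w0 : w != 0 by rewrite sqrtC_eq0 fmorph_eq0.
apply: (@complexI R); apply: (mulfI w0); rewrite det_tridiag_complex //.
set u := (shiftv n lam)%:C.
have SE : S%:C = \sum_(1 <= k < (uphalf n).+1)
    ('C(n, 2 * k - 1))%:R * u ^+ (n - (2 * k - 1)) * (w ^+ 2) ^+ (k - 1).
  rewrite /S rmorph_sum; apply: eq_bigr => k _.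
  by rewrite w2 !rmorphM !rmorphXn rmorph_nat.
have signE : (-1) ^+ n = - (-1) ^+ (n - 1) :> R[i].
  by rewrite -{1}(subnK n_gt0) addn1 exprS mulN1r.
have twoE : 2 ^+ n = 2 * 2 ^+ (n - 1) :> R[i].
  by rewrite -{1}(subnK n_gt0) addn1 exprS.
have two0 : 2 ^+ (n - 1) != 0 :> R[i] by rewrite expf_neq0.
rewrite (exprNn ((u - w) / 2)) (exprNn ((u + w) / 2)) !expr_div_n signE twoE.
have := exprD_sub_exprB u w n; rewrite -SE => /eqP; rewrite subr_eq => /eqP ->.
rewrite !rmorphM fmorphV !rmorphXn rmorphN rmorph1 rmorph_nat.
by field.
Qed.

(** * Continuity and the limits at [0] and [4 * n] *)

Lemma continuous_det_tridiag (R : realType) (m : nat) :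
  continuous (fun x : R => \det (tridiag x m)).
Proof.
suff [] : continuous (fun x : R => \det (tridiag x m)) /\
  continuous (fun x : R => \det (tridiag x m.+1)) by [].
elim: m => [|m [IH0 IH1]].
  split.
    by under [X in continuous X]funext do rewrite det_tridiag0;
      exact: cst_continuous.
  by under [X in continuous X]funext do rewrite det_tridiag1;
    move=> x; exact: cvg_id.
split=> //; under [X in continuous X]funext do rewrite det_tridiagSS.
move=> x; apply: cvgB; last exact: IH0.
by apply: cvgM; [exact: cvg_id|exact: IH1].
Qed.

Lemma continuous_altcharpoly (R : realType) (n : nat) : (0 < n)%N ->
  continuous (fun x : R => altcharpoly n x).
Proof.
move=> n_gt0; under [X in continuous X]funext do rewrite altcharpolyE //.
move=> x; apply: cvgMl.
apply: (continuous_comp (f := fun x => - shiftv n x)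
  (g := fun x => \det (tridiag x n.-1))); last exact: continuous_det_tridiag.
apply: cvgN; apply: cvgB; last exact: cvg_cst.
by apply: cvgMl; exact: cvg_id.
Qed.

Lemma continuous_real_complex (R : realType) :
  continuous (fun x : R => x%:C : R[i]^o).
Proof.
move=> x; apply/cvgrPdist_lt => e e0.
(* A positive complex number is real, so the bound can be compared in [R], where the embedding is an
   isometry. *)
have eE : e = (complex.Re e)%:C by rewrite RRe_real // gtr0_real.
move: e0; rewrite eE ltcR => e0; near=> y.
rewrite -rmorphB normc_def /= expr0n addr0 sqrtr_sqr ltcR; near: y.
exact: (@cvgr_dist_lt _ _ _ (nbhs x)).
Unshelve. all: by end_near.
Qed.

Lemma near_dnbhs_neq (R : realType) (x p : R) : \forall y \near x^', y != p.
Proof.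
have [->|xp] := eqVneq x p; first exact: nbhs_dnbhs_neq.
by apply/nbhs_dnbhs/open_nbhs_nbhs; split; first exact: open_neq.
Qed.

Theorem lemma1 (R : realType) (n : nat) (hn : (2 <= n)%N)
    (sqrt_discr : R -> R[i])
    (hsqrt : forall x : R, sqrt_discr x ^+ 2 = (discr n x)%:C)
    (lam : R) :
  [/\ lam \notin [:: 0; 4 * n%:R] ->
        (altcharpoly n lam)%:C = root_form n lam (sqrt_discr lam),
      lam \in [:: 0; 4 * n%:R] ->
        (fun x : R => root_form n x (sqrt_discr x) : R[i]^o) @ lam^'
          --> ((altcharpoly n lam)%:C : R[i]^o)
    & altcharpoly n lam = binomial_form n lam].
Proof.
have n_gt0 : (0 < n)%N by exact: ltnW.
split; first exact: altcharpoly_root_form.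
- move=> lamP.
  (* Close to [lam] but away from it, both exceptional values are avoided, so [root_form] agrees
     with the continuous [altcharpoly] whichever root is chosen at each point. *)
  apply: (@cvg_trans _ ((fun x : R => (altcharpoly n x)%:C : R[i]^o) @ lam^')).
    apply: near_eq_cvg; near=> x; apply: altcharpoly_root_form => //.
    rewrite !inE negb_or; apply/andP; split; near: x; exact: near_dnbhs_neq.
  apply: cvg_trans (continuous_comp (@continuous_altcharpoly R n n_gt0 lam)
    (@continuous_real_complex R _)).
  exact: cvg_app (@nbhs_dnbhs _ lam).
- exact: altcharpoly_binomial_form.
Unshelve. all: by end_near.
Qed.
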